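(* Let $M$ be a right $R$-module and $S=\mathrm{End}_R(M)$. The following are equivalent: (a) $M$ is a finite $\Sigma$-Rickart module; (b) $S$ is a right semi-hereditary ring and $M$ is flat as a left $S$-module; (c) $M$ is intrinsically projective, $M$ is $M$-coherent, and every right ideal of $S$ is flat.
   Context: $M$ is a left $S$-module via evaluation. $M^{(n)}$ is the direct sum of $n$ copies of $M$. $M$ is Rickart if $\ker\varphi$ is a direct summand of $M$ for all $\varphi\in\mathrm{End}_R(M)$; $M$ is finite $\Sigma$-Rickart if $M^{(n)}$ is Rickart for all $n>0$. A ring is right semi-hereditary if every finitely generated right ideal is projective. A module $N$ is finitely $M$-generated if there is an epimorphism $M^{(n)}\to N$ for some $n>0$; such an $N$ is $M$-coherent if for every $n>0$ and every homomorphism $\rho:M^{(n)}\to N$, $\ker\rho$ is finitely $M$-generated. $M$ is intrinsically projective if for every integer $n>0$, every submodule $N\le M$, every epimorphism $\alpha:M^{(n)}\to N$ and every homomorphism $\beta:M\to N$, there exists $\gamma:M\to M^{(n)}$ with $\alpha\gamma=\beta$. *)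

(* Defs.v *)
From HB Require Import structures.
From mathcomp Require Import all_boot all_algebra.
From mathcomp Require Import boolp.
Set Implicit Arguments. Unset Strict Implicit. Unset Printing Implicit Defensive.
Import GRing.Theory.
Local Open Scope ring_scope.

Definition is_endo (R : nzRingType) (M : lmodType R^c) (f : M -> M) : Prop :=
  (forall x y : M, f (x + y) = f x + f y) /\ (forall (r : R^c) (x : M), f (r *: x) = r *: f x).

Record endo (R : nzRingType) (M : lmodType R^c) := Endo { efun :> M -> M; efunP : is_endo efun }.

HB.instance Definition _ (R : nzRingType) (M : lmodType R^c) := gen_eqMixin (endo M).
HB.instance Definition _ (R : nzRingType) (M : lmodType R^c) := gen_choiceMixin (endo M).

Lemma endo_ext (R : nzRingType) (M : lmodType R^c) (f g : endo M) :
  (forall x, f x = g x) -> f = g.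
Proof.
case: f g => f fP [g gP] /= fg; have efg : f = g by apply: funext.
subst g; congr Endo; exact: Prop_irrelevance.
Qed.

Fact endo0P (R : nzRingType) (M : lmodType R^c) : is_endo (fun _ : M => 0 : M).
Proof. by split=> [x y|r x]; rewrite ?addr0 ?scaler0. Qed.
Fact endoNP (R : nzRingType) (M : lmodType R^c) (f : endo M) : is_endo (fun x => - f x).
Proof. case: f => f [fD fZ]; split=> [x y|r x] /=; by rewrite ?fD ?fZ ?opprD ?scalerN. Qed.
Fact endoDP (R : nzRingType) (M : lmodType R^c) (f g : endo M) : is_endo (fun x => f x + g x).
Proof.
case: f g => f [fD fZ] [g [gD gZ]]; split=> [x y|r x] /=.
  by rewrite fD gD addrACA.
by rewrite fZ gZ scalerDr.
Qed.
Fact endo1P (R : nzRingType) (M : lmodType R^c) : is_endo (fun x : M => x).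
Proof. by []. Qed.
Fact endoMP (R : nzRingType) (M : lmodType R^c) (f g : endo M) : is_endo (fun x => f (g x)).
Proof.
case: f g => f [fD fZ] [g [gD gZ]]; split=> [x y|r x] /=; by rewrite ?gD ?fD ?gZ ?fZ.
Qed.

Definition endo_zero R M := Endo (@endo0P R M).
Definition endo_opp R M (f : endo M) := Endo (@endoNP R M f).
Definition endo_add R M (f g : endo M) := Endo (@endoDP R M f g).
Definition endo_one R M := Endo (@endo1P R M).
Definition endo_mul R M (f g : endo M) := Endo (@endoMP R M f g).

Fact endo_addA R M : associative (@endo_add R M).
Proof. by move=> f g h; apply: endo_ext => x /=; rewrite addrA. Qed.
Fact endo_addC R M : commutative (@endo_add R M).
Proof. by move=> f g; apply: endo_ext => x /=; rewrite addrC. Qed.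
Fact endo_add0 R M : left_id (@endo_zero R M) (@endo_add R M).
Proof. by move=> f; apply: endo_ext => x /=; rewrite add0r. Qed.
Fact endo_addN R M : left_inverse (@endo_zero R M) (@endo_opp R M) (@endo_add R M).
Proof. by move=> f; apply: endo_ext => x /=; rewrite addNr. Qed.

HB.instance Definition _ (R : nzRingType) (M : lmodType R^c) :=
  GRing.isZmodule.Build (endo M) (@endo_addA R M) (@endo_addC R M) (@endo_add0 R M) (@endo_addN R M).

Fact endo_mulA R M : associative (@endo_mul R M).
Proof. by move=> f g h; apply: endo_ext. Qed.
Fact endo_mul1 R M : left_id (@endo_one R M) (@endo_mul R M).
Proof. by move=> f; apply: endo_ext. Qed.
Fact endo_mulr1 R M : right_id (@endo_one R M) (@endo_mul R M).
Proof. by move=> f; apply: endo_ext. Qed.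
Fact endo_mulDl R M : left_distributive (@endo_mul R M) +%R.
Proof. by move=> f g h; apply: endo_ext. Qed.
Fact endo_mulDr R M : right_distributive (@endo_mul R M) +%R.
Proof. by move=> f g h; apply: endo_ext => x /=; case: f => f [fD _] /=; rewrite fD. Qed.


HB.instance Definition _ (R : nzRingType) (M : lmodType R^c) :=
  GRing.Zmodule_isPzRing.Build (endo M) (@endo_mulA R M) (@endo_mul1 R M) (@endo_mulr1 R M)
    (@endo_mulDl R M) (@endo_mulDr R M).

Definition rmod_ax (S : pzRingType) (A : zmodType) (ra : A -> S -> A) : Prop :=
  [/\ forall (a b : A) s, ra (a + b) s = ra a s + ra b s,
      forall a (s t : S), ra a (s + t) = ra a s + ra a t,
      forall a (s t : S), ra a (s * t) = ra (ra a s) t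
    & forall a, ra a 1 = a].

Definition lmod_ax (S : pzRingType) (B : zmodType) (la : S -> B -> B) : Prop :=
  [/\ forall s (a b : B), la s (a + b) = la s a + la s b,
      forall (s t : S) b, la (s + t) b = la s b + la t b,
      forall (s t : S) b, la (s * t) b = la s (la t b)
    & forall b, la 1 b = b].

Definition rsubmod (S : pzRingType) (A : zmodType) (ra : A -> S -> A) (P : A -> Prop) : Prop :=
  [/\ P 0, forall a b, P a -> P b -> P (a - b) & forall a s, P a -> P (ra a s)].

Definition lsubmod (S : pzRingType) (B : zmodType) (la : S -> B -> B) (Q : B -> Prop) : Prop :=
  [/\ Q 0, forall a b, Q a -> Q b -> Q (a - b) & forall s b, Q b -> Q (la s b)].

Definition rhom_on (S : pzRingType) (A B : zmodType) (ra : A -> S -> A) (rb : B -> S -> B)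
  (P : A -> Prop) (h : A -> B) : Prop :=
  (forall x y, P x -> P y -> h (x + y) = h x + h y) /\
  (forall x s, P x -> h (ra x s) = rb (h x) s).

(* For a right S-module A (action ra) with submodule P and a left S-module B *)
(* (action la) with submodule Q, P (x)_S Q is the free abelian group on P x Q *)
(* modulo the subgroup generated by the bilinearity / balancing relations.  *)
(* Elements of the free abelian group are represented by formal sums        *)
(* (finite lists of (coefficient, generator)); two formal sums are equal iff *)
(* all their coefficients agree.                                             *)

Definition fsum (A B : eqType) := seq (int * (A * B)).

Definition fcoef (A B : eqType) (x : fsum A B) (p : A * B) : int :=
  \sum_(e <- x | e.2 == p) e.1.

Definition fscale (A B : eqType) (k : int) (x : fsum A B) : fsum A B :=
  [seq (k * e.1, e.2) | e <- x].

Inductive trel (S A B : Type) :=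
  | TR_addl of A & A & B      (* (a + a') (x) b - a (x) b - a' (x) b *)
  | TR_addr of A & B & B      (* a (x) (b + b') - a (x) b - a (x) b' *)
  | TR_bal  of A & S & B.     (* (a.s) (x) b - a (x) (s.b)          *)

Definition trel_fsum (S : pzRingType) (A B : zmodType) (ra : A -> S -> A) (la : S -> B -> B)
  (g : trel S A B) : fsum A B :=
  match g with
  | TR_addl a a' b => [:: (1%R, (a + a', b)); (-1, (a, b)); (-1, (a', b))]
  | TR_addr a b b' => [:: (1%R, (a, b + b')); (-1, (a, b)); (-1, (a, b'))]
  | TR_bal a s b => [:: (1%R, (ra a s, b)); (-1, (a, la s b))]
  end.

Definition trel_in (S : pzRingType) (A B : zmodType) (P : A -> Prop) (Q : B -> Prop)
  (g : trel S A B) : Prop :=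
  match g with
  | TR_addl a a' b => [/\ P a, P a' & Q b]
  | TR_addr a b b' => [/\ P a, Q b & Q b']
  | TR_bal a _ b => P a /\ Q b
  end.

Definition fsum_in (A B : zmodType) (P : A -> Prop) (Q : B -> Prop) (x : fsum A B) : Prop :=
  forall e, e \in x -> P e.2.1 /\ Q e.2.2.

Definition tensor_zero (S : pzRingType) (A B : zmodType) (ra : A -> S -> A) (la : S -> B -> B)
  (P : A -> Prop) (Q : B -> Prop) (x : fsum A B) : Prop :=
  exists (m : nat) (gs : 'I_m -> int * trel S A B),
    (forall i, trel_in P Q (gs i).2) /\
    forall p, fcoef x p = fcoef (flatten [seq fscale (gs i).1 (trel_fsum ra la (gs i).2) | i <- enum 'I_m]) p.

(* The submodule Q of the left S-module B is flat: for every right S-module *)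
(* A and submodule P' of A, the natural map P' (x)_S Q -> A (x)_S Q is       *)
(* injective.                                                               *)
Definition flat_left (S : pzRingType) (B : zmodType) (la : S -> B -> B) (Q : B -> Prop) : Prop :=
  forall (A : zmodType) (ra : A -> S -> A), rmod_ax ra ->
  forall P' : A -> Prop, rsubmod ra P' ->
  forall x : fsum A B, fsum_in P' Q x ->
    tensor_zero ra la (fun _ => True) Q x -> tensor_zero ra la P' Q x.

(* The submodule P of the right S-module A is flat: for every left S-module *)
(* B and submodule Q' of B, the natural map P (x)_S Q' -> P (x)_S B is       *)
(* injective.                                                               *)
Definition flat_right (S : pzRingType) (A : zmodType) (ra : A -> S -> A) (P : A -> Prop) : Prop :=
  forall (B : zmodType) (la : S -> B -> B), lmod_ax la ->
  forall Q' : B -> Prop, lsubmod la Q' ->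
  forall x : fsum A B, fsum_in P Q' x ->
    tensor_zero ra la P (fun _ => True) x -> tensor_zero ra la P Q' x.

Definition projective_right (S : pzRingType) (A : zmodType) (ra : A -> S -> A) (P : A -> Prop) : Prop :=
  forall (B C : zmodType) (rb : B -> S -> B) (rc : C -> S -> C), rmod_ax rb -> rmod_ax rc ->
  forall g : B -> C, rhom_on rb rc (fun _ => True) g -> (forall c, exists b, g b = c) ->
  forall h : A -> C, rhom_on ra rc P h ->
  exists k : A -> B, rhom_on ra rb P k /\ (forall x, P x -> g (k x) = h x).

Definition right_ideal (S : pzRingType) (I : S -> Prop) : Prop :=
  rsubmod (fun x s : S => x * s) I.

Definition fg_right_ideal (S : pzRingType) (I : S -> Prop) : Prop :=
  exists (n : nat) (a : 'I_n -> S),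
    forall x, I x <-> exists c : 'I_n -> S, x = \sum_(i < n) a i * c i.

Definition right_semihereditary (S : pzRingType) : Prop :=
  forall I : S -> Prop, right_ideal I -> fg_right_ideal I ->
    projective_right (fun x s : S => x * s) I.

(* Notions for the right R-module M (an lmodType over the converse ring).   *)
(* M^(n) is {ffun 'I_n -> M}; R-homomorphisms are {linear _ -> _}.          *)

Definition submodV (K : pzRingType) (V : lmodType K) (Q : V -> Prop) : Prop :=
  [/\ Q 0, forall x y, Q x -> Q y -> Q (x - y) & forall k x, Q x -> Q (k *: x)].

Definition direct_summand (K : pzRingType) (V : lmodType K) (P : V -> Prop) : Prop :=
  submodV P /\
  exists Q : V -> Prop, [/\ submodV Q,
    (forall x, P x -> Q x -> x = 0) &
    (forall x, exists y z, [/\ P y, Q z & x = y + z])].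

Definition rickart (K : pzRingType) (V : lmodType K) : Prop :=
  forall phi : {linear V -> V}, direct_summand (fun x => phi x = 0).

Definition fin_sigma_rickart (K : pzRingType) (M : lmodType K) : Prop :=
  forall n : nat, (0 < n)%N -> rickart {ffun 'I_n -> M}.

Definition fin_Mgen (K : pzRingType) (M V : lmodType K) (N : V -> Prop) : Prop :=
  exists n : nat, (0 < n)%N /\
    exists tau : {linear {ffun 'I_n -> M} -> V},
      (forall x, N (tau x)) /\ (forall y, N y -> exists x, tau x = y).

Definition M_coherent (K : pzRingType) (M V : lmodType K) (N : V -> Prop) : Prop :=
  fin_Mgen M N /\
  forall n : nat, (0 < n)%N ->
  forall rho : {linear {ffun 'I_n -> M} -> V}, (forall x, N (rho x)) ->
    fin_Mgen M (fun x => rho x = 0).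

Definition intrinsically_projective (K : pzRingType) (M : lmodType K) : Prop :=
  forall n : nat, (0 < n)%N ->
  forall N : M -> Prop, submodV N ->
  forall alpha : {linear {ffun 'I_n -> M} -> M},
    (forall x, N (alpha x)) -> (forall y, N y -> exists x, alpha x = y) ->
  forall beta : {linear M -> M}, (forall x, N (beta x)) ->
  exists gamma : {linear M -> {ffun 'I_n -> M}}, forall x, alpha (gamma x) = beta x.

Definition eval_act (R : nzRingType) (M : lmodType R^c) (s : endo M) (m : M) : M := s m.

(* Main.v *)
(* Write S for the endomorphism ring of M, so that linear maps M^n -> M^m are
   matrices over S. All three conditions are compared with the following
   property: for every matrix C over S there is a matrix E with C E = 0 that
   fixes every x in ker C (so that E is a projection onto ker C). An induction
   on the rows of C reduces this property to single rows c.

   Flatness enters through the equational criterion for finite systems: a left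
   module B is flat iff C b = 0 implies b = D y with C D = 0.
   - If E projects onto ker c, then x = E x is such a factorisation in M, while
     1 - E exhibits c S as a direct summand of S^n and, for c with entries in a
     right ideal I, gives the factorisation c = c (1 - E) needed for I.
   - If c S is projective, the kernel of c on S^n is the image of a projection E,
     and the factorisations x = D y of flatness carry this over to M^n.
   - If ker c is the image of T : M^m -> M^n and c S is flat, then c T = 0 gives
     c = b D with D T = 0 and b = c F, and E := 1 - F D works. *)
Require Import Defs.
From HB Require Import structures.
From mathcomp Require Import all_boot all_algebra.
From mathcomp Require Import boolp functions.
Set Implicit Arguments. Unset Strict Implicit. Unset Printing Implicit Defensive.
Import GRing.Theory.
Local Open Scope ring_scope.

(** * Tensor products and maps balanced modulo a subgroup *)

Definition is_subgroup (H : zmodType) (N : H -> Prop) : Prop :=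
  N 0 /\ forall a b, N a -> N b -> N (a - b).

(** Congruence modulo [N] stands for equality in the quotient [H / N], which is never formed as a
    type. *)
Definition eqmod (H : zmodType) (N : H -> Prop) (a b : H) : Prop := N (a - b).

Lemma subgroupN (H : zmodType) (N : H -> Prop) : is_subgroup N ->
  forall a, N a -> N (- a).
Proof. by move=> [N0 NB] a Na; rewrite -(sub0r a); apply: NB. Qed.

Lemma subgroupD (H : zmodType) (N : H -> Prop) : is_subgroup N ->
  forall a b, N a -> N b -> N (a + b).
Proof.
by move=> sN a b Na Nb; rewrite -(opprK b); apply: sN.2 => //; apply: subgroupN.
Qed.

Lemma subgroup_sum (H : zmodType) (N : H -> Prop) : is_subgroup N ->
  forall (I : eqType) (r : seq I) (F : I -> H),
    (forall i, i \in r -> N (F i)) -> N (\sum_(i <- r) F i).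
Proof.
move=> sN I r F NF; rewrite big_seq; apply: big_ind => //; first exact: sN.1.
exact: subgroupD.
Qed.

Lemma subgroup_mulrz (H : zmodType) (N : H -> Prop) : is_subgroup N ->
  forall a k, N a -> N (a *~ k).
Proof.
move=> sN a k Na; have Nn n : N (a *+ n).
  by elim: n => [|n IH]; [apply: sN.1 | rewrite mulrS; apply: subgroupD].
by case: k => n; [apply: Nn | rewrite NegzE mulrNz; apply: subgroupN => //; apply: Nn].
Qed.

Lemma eqmod_refl (H : zmodType) (N : H -> Prop) : is_subgroup N ->
  forall a, eqmod N a a.
Proof. by move=> sN a; rewrite /eqmod subrr; apply: sN.1. Qed.

Lemma eqmod_sym (H : zmodType) (N : H -> Prop) : is_subgroup N ->
  forall a b, eqmod N a b -> eqmod N b a.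
Proof. by move=> sN a b /(subgroupN sN); rewrite opprB. Qed.

Lemma eqmod_trans (H : zmodType) (N : H -> Prop) : is_subgroup N ->
  forall b a c, eqmod N a b -> eqmod N b c -> eqmod N a c.
Proof.
by move=> sN b a c Nab Nbc; have := subgroupD sN Nab Nbc; rewrite addrA subrK.
Qed.

Lemma eqmodD (H : zmodType) (N : H -> Prop) : is_subgroup N ->
  forall a b c d, eqmod N a b -> eqmod N c d -> eqmod N (a + c) (b + d).
Proof.
by move=> sN a b c d Nab Ncd; have := subgroupD sN Nab Ncd; rewrite addrACA -opprD.
Qed.

Lemma eqmodIr (H : zmodType) (N : H -> Prop) (c a b : H) :
  eqmod N (a + c) (b + c) -> eqmod N a b.
Proof. by rewrite /eqmod opprD addrACA subrr addr0. Qed.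

Lemma eqmodMz (H : zmodType) (N : H -> Prop) : is_subgroup N ->
  forall a b k, eqmod N a b -> eqmod N (a *~ k) (b *~ k).
Proof. by move=> sN a b k Nab; rewrite /eqmod -mulrzBl; apply: subgroup_mulrz. Qed.

Lemma eqmod_sum (H : zmodType) (N : H -> Prop) : is_subgroup N ->
  forall (I : eqType) (r : seq I) (F G : I -> H),
  (forall i, i \in r -> eqmod N (F i) (G i)) ->
  eqmod N (\sum_(i <- r) F i) (\sum_(i <- r) G i).
Proof. by move=> sN I r F G NFG; rewrite /eqmod -sumrB; apply: subgroup_sum. Qed.

Lemma subgroup_eqmod (H : zmodType) (N : H -> Prop) : is_subgroup N ->
  forall a b, eqmod N a b -> N b -> N a.
Proof. by move=> sN a b Nab Nb; rewrite -(subrK b a); apply: subgroupD. Qed.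

Lemma eqmod_additive0 (A H : zmodType) (P : A -> Prop) (N : H -> Prop) (g : A -> H) :
  is_subgroup P -> is_subgroup N ->
  (forall a b, P a -> P b -> eqmod N (g (a + b)) (g a + g b)) -> eqmod N (g 0) 0.
Proof.
move=> sP sN gD; apply: (@eqmodIr _ _ (g 0)); rewrite add0r.
by apply: eqmod_sym => //; have := gD 0 0 sP.1 sP.1; rewrite addr0.
Qed.

(** Natural multiples come by induction, opposites from [g 0] being congruent to [0]. The lemma
    moves the coefficients of a formal sum through one argument of a balanced map. *)
Lemma eqmod_additive_sum (A H : zmodType) (P : A -> Prop) (N : H -> Prop) (g : A -> H) :
  is_subgroup P -> is_subgroup N ->
  (forall a b, P a -> P b -> eqmod N (g (a + b)) (g a + g b)) ->
  forall (I : eqType) (r : seq I) (u : I -> A) (k : I -> int),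
  (forall i, i \in r -> P (u i)) ->
  eqmod N (g (\sum_(i <- r) u i *~ k i)) (\sum_(i <- r) g (u i) *~ k i).
Proof.
move=> sP sN gD; have g0 := eqmod_additive0 sP sN gD.
have gn a n : P a -> eqmod N (g (a *+ n)) (g a *+ n).
  move=> Pa; elim: n => [|n IH]; first by rewrite !mulr0n.
  rewrite !mulrS; apply: (eqmod_trans sN (gD _ _ Pa (subgroup_mulrz sP n Pa))).
  by apply: eqmodD => //; apply: eqmod_refl.
have gN a : P a -> eqmod N (g (- a)) (- g a).
  move=> Pa; apply: (@eqmodIr _ _ (g a)); rewrite addNr.
  apply: eqmod_trans g0 => //; apply: eqmod_sym => //.
  by rewrite -(addNr a); apply: gD => //; apply: subgroupN.
have gz a k : P a -> eqmod N (g (a *~ k)) (g a *~ k).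
  move=> Pa; case: k => n; first exact: gn.
  rewrite NegzE !mulrNz; apply: (eqmod_trans sN (gN _ (subgroup_mulrz sP n.+1 Pa))).
  by have := eqmodMz sN (-1) (gn _ n.+1 Pa); rewrite !mulrN1z.
move=> I r u k; elim: r => [|i r IH] Pu; first by rewrite !big_nil.
have Pi : P (u i) by apply: Pu; rewrite mem_head.
have Pr j : j \in r -> P (u j) by move=> jr; apply: Pu; rewrite inE jr orbT.
rewrite !big_cons; apply: (eqmod_trans sN (gD _ _ _ _)).
- exact: subgroup_mulrz.
- by apply: subgroup_sum => // j jr; apply: subgroup_mulrz => //; apply: Pr.
- by apply: eqmodD => //; [apply: gz | apply: IH].
Qed.

(** The additive extension of [f] to the free abelian group on pairs. *)
Definition feval (A B : eqType) (H : zmodType) (f : A -> B -> H) (x : fsum A B) : H :=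
  \sum_(e <- x) f e.2.1 e.2.2 *~ e.1.

(** Terms are grouped by generator. The list [r] may exceed the support of [x], so that one [r]
    serves two formal sums at once. *)
Lemma feval_coef (A B : eqType) (H : zmodType) (f : A -> B -> H) (x : fsum A B)
  (r : seq (A * B)) : uniq r -> {subset [seq e.2 | e <- x] <= r} ->
  feval f x = \sum_(p <- r) f p.1 p.2 *~ fcoef x p.
Proof.
move=> ur xr.
transitivity (\sum_(e <- x) \sum_(p <- r | e.2 == p) f p.1 p.2 *~ e.1).
  rewrite /feval; apply: eq_big_seq => e ex.
  have er : e.2 \in r by apply: xr; apply: map_f.
  by rewrite -[RHS]big_filter (eq_filter (a2 := pred1 e.2)) ?filter_pred1_uniq ?big_seq1 //.
rewrite (exchange_big_dep xpredT) //=; apply: eq_bigr => p _.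
by rewrite /fcoef mulrz_sumr.
Qed.

Lemma eq_feval (A B : eqType) (H : zmodType) (f : A -> B -> H) (x y : fsum A B) :
  (forall p, fcoef x p = fcoef y p) -> feval f x = feval f y.
Proof.
move=> xy; set r := undup [seq e.2 | e <- x ++ y].
have sr z : {subset z <= x ++ y} -> {subset [seq e.2 | e <- z] <= r}.
  by move=> sz p /mapP[e ez ->]; rewrite mem_undup; apply: map_f; apply: sz.
rewrite !(@feval_coef _ _ _ _ _ r) ?undup_uniq //.
- by apply: eq_bigr => p _; rewrite xy.
- by apply: sr => e ey; rewrite mem_cat ey orbT.
- by apply: sr => e ex; rewrite mem_cat ex.
Qed.

Lemma feval_scale (A B : eqType) (H : zmodType) (f : A -> B -> H) k (x : fsum A B) :
  feval f (fscale k x) = feval f x *~ k.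
Proof.
rewrite /feval big_map mulrz_suml; apply: eq_bigr => e _ /=.
by rewrite -mulrzA mulrC.
Qed.

Lemma feval_flatten (A B : eqType) (H : zmodType) (f : A -> B -> H) (I : Type)
  (r : seq I) (x : I -> fsum A B) :
  feval f (flatten [seq x i | i <- r]) = \sum_(i <- r) feval f (x i).
Proof. by rewrite /feval big_flatten big_map. Qed.

(** Stated for arbitrary [f], as it also serves for a map that annihilates only the finitely many
    relations of one given witness. *)
Lemma feval_relations (S : pzRingType) (A B : zmodType) (ra : A -> S -> A) (la : S -> B -> B)
  (H : zmodType) (f : A -> B -> H) (x : fsum A B) m (gs : 'I_m -> int * trel S A B) :
  (forall p, fcoef x p =
    fcoef (flatten [seq fscale (gs i).1 (trel_fsum ra la (gs i).2) | i <- enum 'I_m]) p) ->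
  feval f x = \sum_(i <- enum 'I_m) feval f (trel_fsum ra la (gs i).2) *~ (gs i).1.
Proof.
move=> /(eq_feval f) ->; rewrite feval_flatten.
by apply: eq_bigr => i _; rewrite feval_scale.
Qed.

(** Balanced maps from [P x Q] to [H / N]. As [f] is total, the conditions are limited to arguments
    in [P] and [Q]. *)
Definition balanced_mod (S : pzRingType) (A B : zmodType) (ra : A -> S -> A)
  (la : S -> B -> B) (P : A -> Prop) (Q : B -> Prop) (H : zmodType) (N : H -> Prop)
  (f : A -> B -> H) : Prop :=
  [/\ forall b, Q b -> forall a a', P a -> P a' -> eqmod N (f (a + a') b) (f a b + f a' b),
      forall a, P a -> forall b b', Q b -> Q b' -> eqmod N (f a (b + b')) (f a b + f a b')
    & forall a s b, P a -> Q b -> eqmod N (f (ra a s) b) (f a (la s b))].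

(** One half of the universal property: each defining relation evaluates into [N], hence so does
    every integer combination. *)
Lemma tensor_zero_balanced (S : pzRingType) (A B : zmodType) (ra : A -> S -> A)
  (la : S -> B -> B) (P : A -> Prop) (Q : B -> Prop) (x : fsum A B) :
  tensor_zero ra la P Q x ->
  forall (H : zmodType) (N : H -> Prop) (f : A -> B -> H),
  is_subgroup N -> balanced_mod ra la P Q N f -> N (feval f x).
Proof.
move=> [m [gs [gsP xgs]]] H N f sN [fDl fDr fb].
rewrite (feval_relations _ xgs); apply: subgroup_sum => // i _.
apply: subgroup_mulrz => //; move: (gsP i).
case: (gs i).2 => [a a' b [Pa Pa' Qb]|a b b' [Pa Qb Qb']|a s b [Pa Qb]];
  rewrite /feval /= !big_cons big_nil /= mulr1z ?mulrN1z addr0.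
- by rewrite -opprD; apply: fDl.
- by rewrite -opprD; apply: fDr.
- exact: fb.
Qed.

Lemma balanced_tensor_zero (S : pzRingType) (A B : zmodType) (ra : A -> S -> A)
  (la : S -> B -> B) (P : A -> Prop) (Q : B -> Prop) (x : fsum A B) :
  (forall (H : zmodType) (N : H -> Prop) (f : A -> B -> H),
    is_subgroup N -> balanced_mod ra la P Q N f -> N (feval f x)) ->
  tensor_zero ra la P Q x.
Proof.
(* The universal target: the free abelian group on A * B, realised inside
   A * B -> int, modulo the subgroup N of the defining relations. *)
set rels := fun m (gs : 'I_m -> int * trel S A B) =>
  flatten [seq fscale (gs i).1 (trel_fsum ra la (gs i).2) | i <- enum 'I_m].
pose N (h : A * B -> int) := exists m (gs : 'I_m -> int * trel S A B),
  (forall i, trel_in P Q (gs i).2) /\ forall p, h p = fcoef (rels m gs) p.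
pose f (a : A) (b : B) : A * B -> int := fun p => ((a, b) == p)%:R.
have fE y p : feval f y p = fcoef y p.
  rewrite /feval fct_sumE /fcoef [RHS]big_mkcond /=; apply: eq_bigr => -[k [a b]] _ /=.
  have -> : (f a b *~ k) p = f a b p *~ k.
    by case: k => n; rewrite ?NegzE ?mulrNz -?pmulrn natmulfctE.
  by rewrite /f; case: eqP => _; rewrite ?mul0rz // intz.
have fcoef_rels m gs p :
    fcoef (rels m gs) p = \sum_(i < m) (gs i).1 * fcoef (trel_fsum ra la (gs i).2) p.
  rewrite -fE feval_flatten fct_sumE big_enum /=; apply: eq_bigr => i _.
  by rewrite fE /fcoef big_map mulr_sumr.
move/(_ _ N f) => univ.
have sN : is_subgroup N.
  split; first by exists 0%N, (fun i => (0, TR_addl S 0 0 0)); split=> [[]//|p];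
    rewrite fcoef_rels big_ord0.
  (* Two witnesses are concatenated, with the coefficients of the second one negated. *)
  move=> h h' [m [gs [gsP hE]]] [m' [gs' [gsP' hE']]].
  exists (m + m')%N, (fun i => match fintype.split i with
     inl j => gs j | inr j => (- (gs' j).1, (gs' j).2) end).
  split=> [i|p]; first by case: (fintype.split i) => j /=.
  rewrite fcoef_rels big_split_ord /= -[LHS]/(h p - h' p) hE hE' !fcoef_rels -sumrN.
  congr (_ + _); apply: eq_bigr => i _.
    by rewrite (unsplitK (inl i)).
  by rewrite (unsplitK (inr i)) /= mulNr.
have Nrel g : trel_in P Q g -> N (feval f (trel_fsum ra la g)).
  move=> gP; exists 1%N, (fun _ => (1, g)); split=> // p.
  by rewrite fcoef_rels big_ord1 mul1r fE.
have [m [gs [gsP xE]]] : N (feval f x).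
  apply: univ => //; split=> [b Qb a a' Pa Pa'|a Pa b b' Qb Qb'|a s b Pa Qb].
  - have := @Nrel (TR_addl S a a' b) (And3 Pa Pa' Qb).
    by rewrite /feval /= !big_cons big_nil /= mulr1z ?mulrN1z addr0 -opprD.
  - have := @Nrel (TR_addr S a b b') (And3 Pa Qb Qb').
    by rewrite /feval /= !big_cons big_nil /= mulr1z ?mulrN1z addr0 -opprD.
  - have := @Nrel (TR_bal a s b) (conj Pa Qb).
    by rewrite /feval /= !big_cons big_nil /= mulr1z ?mulrN1z addr0.
by exists m, gs; split=> // p; rewrite -fE xE.
Qed.

(** * The equational criterion for flatness *)

Lemma eqmod_morph_sum (A H : zmodType) (P : A -> Prop) (N : H -> Prop) (g : A -> H) :
  is_subgroup P -> is_subgroup N ->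
  (forall a b, P a -> P b -> eqmod N (g (a + b)) (g a + g b)) ->
  forall n (u : 'I_n -> A), (forall i, P (u i)) ->
  eqmod N (g (\sum_(i < n) u i)) (\sum_(i < n) g (u i)).
Proof.
move=> sP sN gD n u Pu.
by have := eqmod_additive_sum sP sN gD (r := index_enum 'I_n) (fun=> 1) (fun i _ => Pu i).
Qed.

Lemma lmod_zero (S : pzRingType) (B : zmodType) (la : S -> B -> B) : lmod_ax la ->
  forall s, la s 0 = 0.
Proof. by case=> laDr _ _ _ s; apply: (addIr (la s 0)); rewrite -laDr !add0r. Qed.

Lemma lmod_zerol (S : pzRingType) (B : zmodType) (la : S -> B -> B) : lmod_ax la ->
  forall b, la 0 b = 0.
Proof. by case=> _ laDl _ _ b; apply: (addIr (la 0 b)); rewrite -laDl !add0r. Qed.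

Lemma lmod_sumr (S : pzRingType) (B : zmodType) (la : S -> B -> B) : lmod_ax la ->
  forall (I : Type) (r : seq I) (P : pred I) (F : I -> B) s,
  la s (\sum_(i <- r | P i) F i) = \sum_(i <- r | P i) la s (F i).
Proof.
move=> laM I r P F s; apply: (big_morph (la s)); last exact: lmod_zero.
by case: laM => laDr _ _ _ c d; apply: laDr.
Qed.

Lemma lmod_suml (S : pzRingType) (B : zmodType) (la : S -> B -> B) : lmod_ax la ->
  forall (I : Type) (r : seq I) (P : pred I) (F : I -> S) b,
  la (\sum_(i <- r | P i) F i) b = \sum_(i <- r | P i) la (F i) b.
Proof.
move=> laM I r P F b; apply: (big_morph (la^~ b)); last exact: (lmod_zerol laM).
by case: laM => _ laDl _ _ s t; apply: laDl.
Qed.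

Lemma lmodBl (S : pzRingType) (B : zmodType) (la : S -> B -> B) : lmod_ax la ->
  forall s t b, la (s - t) b = la s b - la t b.
Proof.
move=> laM s t b; apply: (addIr (la t b)).
by case: (laM) => _ <- _ _; rewrite !subrK.
Qed.

Lemma lsubmod_subgroup (S : pzRingType) (B : zmodType) (la : S -> B -> B) (Q : B -> Prop) :
  lsubmod la Q -> is_subgroup Q.
Proof. by case. Qed.

Lemma rsubmod_subgroup (S : pzRingType) (A : zmodType) (ra : A -> S -> A) (P : A -> Prop) :
  rsubmod ra P -> is_subgroup P.
Proof. by case. Qed.

(** Exchanging sides through the converse ring makes the lemmas on left modules available for right
    modules. *)
Lemma rmod_conv (S : pzRingType) (A : zmodType) (ra : A -> S -> A) :
  rmod_ax ra -> lmod_ax (S := S^c) (fun s a => ra a s).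
Proof. by case=> raDl raDr raM ra1; split=> * //; rewrite -raM. Qed.

Lemma lmod_conv (S : pzRingType) (B : zmodType) (la : S -> B -> B) :
  lmod_ax la -> rmod_ax (S := S^c) (fun b s => la s b).
Proof. by case=> laDr laDl laM la1; split=> * //; rewrite -laM. Qed.

Lemma sum_fiber (V : nmodType) (I : finType) (T : Type) (r : seq T) (h : T -> I)
  (F : T -> I -> V) :
  \sum_i \sum_(e <- r | h e == i) F e i = \sum_(e <- r) F e (h e).
Proof.
rewrite (exchange_big_dep xpredT) //=; apply: eq_bigr => e _.
by rewrite (big_pred1 (h e)) // => i; rewrite eq_sym.
Qed.

(** One factorisation serves all [r] equations, because a vanishing tensor is witnessed by several
    relations at once. *)
Definition equational_flat (S : pzRingType) (B : zmodType) (la : S -> B -> B)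
  (Q : B -> Prop) : Prop :=
  forall n r (C : 'I_r -> 'I_n -> S) (b : 'I_n -> B), (forall i, Q (b i)) ->
  (forall l, \sum_(i < n) la (C l i) (b i) = 0) ->
  exists k (D : 'I_n -> 'I_k -> S) (y : 'I_k -> B),
    [/\ forall j, Q (y j), forall i, b i = \sum_(j < k) la (D i j) (y j)
      & forall l j, \sum_(i < n) C l i * D i j = 0].

(** The criterion indexed by elements of [B] instead of positions: an element shared by several
    relations receives a single coefficient vector [phi b]. *)
Lemma equational_flat_seq (S : pzRingType) (B : zmodType) (la : S -> B -> B)
  (Q : B -> Prop) : lmod_ax la -> Q 0 -> equational_flat la Q ->
  forall (L : seq B) m (rel : 'I_m -> seq (S * B)),
  (forall b, b \in L -> Q b) ->
  (forall l e, e \in rel l -> e.2 \in L) ->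
  (forall l, \sum_(e <- rel l) la e.1 e.2 = 0) ->
  exists k (phi : B -> 'I_k -> S) (y : 'I_k -> B),
    [/\ forall j, Q (y j), forall b, b \in L -> b = \sum_(j < k) la (phi b j) (y j)
      & forall l j, \sum_(e <- rel l) e.1 * phi e.2 j = 0].
Proof.
move=> laM Q0 flatQ L m rel LQ relL rel0.
(* The additional index keeps the ordinal type inhabited for empty [L]; there [nth] returns the
   default [0], which is where [Q 0] enters. *)
pose idx b : 'I_(size L).+1 := inord (index b L).
have idxK b : b \in L -> nth 0 L (idx b) = b.
  by move=> bL; rewrite inordK ?nth_index // ltnS index_size.
have [i|l|k [D [y [Qy yD CD]]]] := flatQ _ _
    (fun l i => \sum_(e <- rel l | idx e.2 == i) e.1) (fun i => nth 0 L i).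
- have [iL|iL] := ltnP i (size L); last by rewrite nth_default.
  by apply: LQ; apply: mem_nth.
- rewrite -[RHS](rel0 l); under eq_bigr do rewrite (lmod_suml laM).
  rewrite (@sum_fiber _ _ _ (rel l) (fun e => idx e.2) (fun e i => la e.1 (nth 0 L i))).
  by apply: eq_big_seq => e /relL /idxK ->.
exists k, (fun b j => D (idx b) j), y; split=> // [b bL|l j].
  by rewrite -yD idxK.
rewrite -[RHS](CD l j); under [RHS]eq_bigr do rewrite mulr_suml.
by rewrite (@sum_fiber _ _ _ (rel l) (fun e => idx e.2) (fun e i => e.1 * D i j)).
Qed.

Lemma equational_flat_left (S : pzRingType) (B : zmodType) (la : S -> B -> B)
  (Q : B -> Prop) : lmod_ax la -> lsubmod la Q -> equational_flat la Q -> flat_left la Q.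
Proof.
(* Only finitely many relations witness that x vanishes over A. The factorisation
   phi : B -> S^k, defined on the finite set L of elements of B involved, respects
   them, so that every x -> sum a * phi b j already vanishes in A. *)
move=> laM sQ flatQ A ra raM P sP x xPQ [m [gs [gsP xgs]]].
have [Q0 QB QZ] := sQ; have sgQ := lsubmod_subgroup sQ; have sgP := rsubmod_subgroup sP.
(* What each relation asks of [phi]: nothing for additivity in [A], otherwise compatibility with one
   sum or one scalar multiple in [B]. *)
pose rel (i : 'I_m) : seq (S * B) := match (gs i).2 with
  | TR_addl _ _ _ => [::]
  | TR_addr _ b b' => [:: (1, b + b'); (-1, b); (-1, b')]
  | TR_bal _ s b => [:: (1, la s b); (- s, b)]
  end.
pose L := [seq e.2.2 | e <- x] ++ flatten [seq [seq e.2 | e <- rel i] | i <- enum 'I_m].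
have laN s b : la (- s) b = - la s b.
  by rewrite -[- s]sub0r (lmodBl laM) (lmod_zerol laM) sub0r.
have la1 b : la 1 b = b by case: laM.
have [b|l e el|l|k [phi [y [Qy yphi rel0]]]] :=
    @equational_flat_seq _ _ _ _ laM Q0 flatQ L m rel.
- rewrite mem_cat => /orP[/mapP[e ex ->]|/flattenP[_ /mapP[i _ ->] /mapP[e ei ->]]].
    by case: (xPQ _ ex).
  move: (gsP i) ei; rewrite /rel; case: (gs i).2 => [//|a b1 b2 [_ Q1 Q2]|a s b1 [_ Q1]];
    rewrite !inE.
    by case/or3P=> /eqP -> //=; apply: subgroupD.
  by case/orP=> /eqP -> //=; apply: QZ.
- rewrite mem_cat; apply/orP; right; apply/flattenP.
  exists [seq e.2 | e <- rel l]; last exact: map_f.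
  by apply: (map_f (fun i => [seq e.2 | e <- rel i])); rewrite mem_enum.
- rewrite /rel; case: (gs l).2 => [a a' b|a b b'|a s b];
    rewrite ?big_cons big_nil //= !laN !la1 ?addr0.
    by rewrite -opprD subrr.
  by rewrite subrr.
have raM' := rmod_conv raM; have [raDl raDr raA _] := raM.
have xphi j : \sum_(e <- x) ra e.2.1 (phi e.2.2 j) *~ e.1 = 0.
  transitivity (feval (fun a b => ra a (phi b j)) x) => //.
  rewrite (feval_relations _ xgs) big1_seq // => i _.
  move: (rel0 i j); rewrite /rel /feval.
  case: (gs i).2 => [a a' b _|a b b'|a s b];
    rewrite /= !big_cons big_nil /= mulr1z !mulrN1z addr0.
  - by rewrite raDl -opprD subrr mul0rz.
  - rewrite big_nil mul1r !mulN1r addr0 => e0.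
    have {e0} -> : phi (b + b') j = phi b j + phi b' j.
      by apply/eqP; rewrite -subr_eq0 opprD e0.
    by rewrite raDr -opprD subrr mul0rz.
  - rewrite big_nil mul1r addr0 mulNr => /eqP; rewrite subr_eq0 => /eqP ->.
    by rewrite raA subrr mul0rz.
apply: balanced_tensor_zero => H N f sN [fDl fDr fb].
have [P0 PB PZ] := sP.
(* Over [P] and [Q], each tensor of [a] and [b] is the sum over [j] of the tensors of
   [ra a (phi b j)] and [y j]. Summing over [x] first leaves [0] tensored with [y j], by [xphi]. *)
apply: (@subgroup_eqmod _ _ sN _
    (\sum_(e <- x) (\sum_(j < k) f (ra e.2.1 (phi e.2.2 j)) (y j)) *~ e.1)).
  apply: eqmod_sum => // e ex; apply: eqmodMz => //; have [Pe Qe] := xPQ _ ex.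
  have eL : e.2.2 \in L.
    by rewrite mem_cat (map_f (fun e : int * (A * B) => e.2.2)).
  rewrite [X in eqmod _ (f _ X)](yphi _ eL).
  apply: (eqmod_trans sN (eqmod_morph_sum sgQ sN (fDr _ Pe) _)).
    by move=> j; apply: QZ.
  apply: eqmod_sum => // j _; apply: eqmod_sym => //; exact: fb.
under eq_bigr do rewrite mulrz_suml; rewrite exchange_big /=.
apply: subgroup_sum => // j _.
apply: (@subgroup_eqmod _ _ sN _ (f 0 (y j))).
  rewrite -(xphi j); apply: eqmod_sym => //.
  apply: (eqmod_additive_sum sgP sN (fDl _ (Qy j))) => e ex.
  by apply: PZ; case: (xPQ _ ex).
by rewrite -[f _ _]subr0; apply: (eqmod_additive0 sgP sN (fDl _ (Qy j))).
Qed.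

Lemma flat_left_equational (S : pzRingType) (B : zmodType) (la : S -> B -> B)
  (Q : B -> Prop) : lmod_ax la -> lsubmod la Q -> flat_left la Q -> equational_flat la Q.
Proof.
(* The tensor of the columns of C with the b i vanishes over S^r, hence over the
   column span P of C. Sending (C d, b) to d b is balanced modulo the subgroup N of
   the vectors of the required form, and maps that tensor to b. *)
move=> laM sQ flatQ n r C b Qb Cb.
have [Q0 QB QZ] := sQ; have sgQ := lsubmod_subgroup sQ; have [laDr laDl laA la1] := laM.
pose ra (a : {ffun 'I_r -> S}) (s : S) : {ffun 'I_r -> S} := [ffun l => a l * s].
have raM : rmod_ax ra.
  split=> [a a' s|a s t|a s t|a]; apply/ffunP=> l; rewrite !ffunE ?mulrDl ?mulrDr ?mulr1 ?mulrA //.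
pose P (a : {ffun 'I_r -> S}) := exists d : 'I_n -> S, forall l, a l = \sum_(i < n) C l i * d i.
have sP : rsubmod ra P.
  split=> [|a a' [d ad] [d' ad']|a s [d ad]].
  - by exists (fun=> 0) => l; rewrite ffunE big1 // => i _; rewrite mulr0.
  - exists (fun i => d i - d' i) => l; rewrite !ffunE ad ad' -sumrB.
    by apply: eq_bigr => i _; rewrite mulrBr.
  - exists (fun i => d i * s) => l; rewrite ffunE ad mulr_suml.
    by apply: eq_bigr => i _; rewrite mulrA.
pose col i : {ffun 'I_r -> S} := [ffun l => C l i].
pose x : fsum {ffun 'I_r -> S} B := [seq (1, (col i, b i)) | i <- enum 'I_n].
have xE (H : zmodType) (f : {ffun 'I_r -> S} -> B -> H) :
    feval f x = \sum_(i < n) f (col i) (b i).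
  by rewrite /feval big_map big_enum.
have colP i : P (col i).
  exists (fun j => (j == i)%:R) => l; rewrite ffunE (bigD1 i) //= eqxx mulr1 big1 ?addr0 //.
  by move=> j /negPf ->; rewrite mulr0.
have x0 : tensor_zero ra la (fun=> True) Q x.
  apply: balanced_tensor_zero => H N f sN [fDl fDr fb]; rewrite xE.
  have sgT : is_subgroup (fun _ : {ffun 'I_r -> S} => True) by [].
  pose e l : {ffun 'I_r -> S} := [ffun l' => (l' == l)%:R].
  (* In the standard basis [e], moving each [C l i] across the tensor turns [x] into a sum of
     tensors of [e l] with [0], by [Cb]. *)
  have colE i : col i = \sum_(l < r) ra (e l) (C l i).
    apply/ffunP=> l; rewrite sum_ffunE ffunE (bigD1 l) //= !ffunE eqxx mul1r big1 ?addr0 //.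
    by move=> l' /negPf ll'; rewrite !ffunE eq_sym ll' mul0r.
  apply: (@subgroup_eqmod _ _ sN _ (\sum_(i < n) \sum_(l < r) f (e l) (la (C l i) (b i)))).
    apply: eqmod_sum => // i _; rewrite colE.
    apply: (eqmod_trans sN (eqmod_morph_sum sgT sN (fDl _ (Qb i)) _)) => //.
    by apply: eqmod_sum => // l _; apply: fb.
  rewrite exchange_big /=; apply: subgroup_sum => // l _.
  apply: (@subgroup_eqmod _ _ sN _ (f (e l) 0)).
    rewrite -(Cb l); apply: eqmod_sym => //.
    by apply: (eqmod_morph_sum sgQ sN (fDr _ I)) => i; apply: QZ.
  by rewrite -[f _ _]subr0; apply: (eqmod_additive0 sgQ sN (fDr _ I)).
have {x0} x0 : tensor_zero ra la P Q x.
  apply: flatQ => // e /mapP[i _ ->]; split=> //=.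
pose N (h : {ffun 'I_n -> B}) := exists k (D : 'I_n -> 'I_k -> S) (y : 'I_k -> B),
    [/\ forall j, Q (y j), forall i, h i = \sum_(j < k) la (D i j) (y j)
      & forall l j, \sum_(i < n) C l i * D i j = 0].
have sN : is_subgroup N.
  split.
    exists 0%N, (fun _ _ => 0), (fun=> 0); split=> // [i|l [] //].
    by rewrite ffunE big_ord0.
  move=> h h' [k [D [y [Qy hD CD]]]] [k' [D' [y' [Qy' hD' CD']]]].
  (* The columns of [D] and of [- D'] are put side by side. *)
  exists (k + k')%N,
    (fun i j => match fintype.split j with inl j => D i j | inr j => - D' i j end),
    (fun j => match fintype.split j with inl j => y j | inr j => y' j end).
  split=> [j|i|l j].
  - by case: (fintype.split j).
  - rewrite !ffunE hD hD' big_split_ord /= -sumrN; congr (_ + _); apply: eq_bigr => j _.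
      by rewrite (unsplitK (inl j)).
    by rewrite (unsplitK (inr j)) -[- D' i j]sub0r (lmodBl laM) (lmod_zerol laM) sub0r.
  - case: (fintype.split j) => {}j; first exact: CD.
    by under eq_bigr do rewrite mulrN; rewrite sumrN CD' oppr0.
pose act (d : 'I_n -> S) (c : B) : {ffun 'I_n -> B} := [ffun i => la (d i) c].
(* Two coefficient vectors with the same image under [C] differ by a one-column [D] with [C D = 0].
   This makes the arbitrary choice [coef] harmless modulo [N]. *)
have act_eq (d d' : 'I_n -> S) c : Q c ->
    (forall l, \sum_(i < n) C l i * d i = \sum_(i < n) C l i * d' i) ->
    eqmod N (act d c) (act d' c).
  move=> Qc dd'; exists 1%N, (fun i _ => d i - d' i), (fun=> c); split=> // [i|l _].
    by rewrite big_ord1 !ffunE (lmodBl laM).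
  by under eq_bigr do rewrite mulrBr; rewrite sumrB dd' subrr.
pose coef (a : {ffun 'I_r -> S}) : 'I_n -> S :=
  if pselect (P a) is left p then sval (cid p) else fun=> 0.
have coefP a : P a -> forall l, a l = \sum_(i < n) C l i * coef a i.
  by rewrite /coef; case: pselect => // p _; case: (cid p).
have Nx := tensor_zero_balanced x0 (N := N) (f := fun a c => act (coef a) c) sN.
have [||k [D [y [Qy bD CD]]]] :=
    @subgroup_eqmod _ _ sN [ffun i => b i] (feval (fun a c => act (coef a) c) x).
(* The vector [b] is the sum of the unit vectors acting on the [b i], and the [i]-th unit vector is
   another coefficient vector of [col i]. *)
- rewrite xE (_ : finfun _ = \sum_(i < n) act (fun j => (j == i)%:R) (b i)).
    apply: eqmod_sum => // i _; apply: act_eq => // l; rewrite -coefP // ffunE.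
    rewrite (bigD1 i) //= eqxx mulr1 big1 ?addr0 // => j /negPf ->; exact: mulr0.
  apply/ffunP=> i; rewrite sum_ffunE ffunE (bigD1 i) //= !ffunE eqxx la1 big1 ?addr0 //.
  by move=> j /negPf ij; rewrite !ffunE eq_sym ij (lmod_zerol laM).
- apply: Nx; split=> [c Qc a a' Pa Pa'|a Pa c c' Qc Qc'|a s c Pa Qc].
  + have -> : act (coef a) c + act (coef a') c = act (fun i => coef a i + coef a' i) c.
      by apply/ffunP=> i; rewrite !ffunE laDl.
    apply: act_eq => // l; under [RHS]eq_bigr do rewrite mulrDr.
    rewrite big_split /= -!coefP // ?ffunE //.
    by apply: (subgroupD (rsubmod_subgroup sP)).
  + have -> : act (coef a) (c + c') = act (coef a) c + act (coef a) c'.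
      by apply/ffunP=> i; rewrite !ffunE laDr.
    exact: eqmod_refl.
  + have -> : act (coef a) (la s c) = act (fun i => coef a i * s) c.
      by apply/ffunP=> i; rewrite !ffunE laA.
    apply: act_eq => // l; under [RHS]eq_bigr do rewrite mulrA.
    rewrite -mulr_suml -!coefP // ?ffunE //.
    by case: sP => _ _; apply.
by exists k, D, y; split=> // i; rewrite -bD ffunE.
Qed.

(** * Exchanging the two sides of a tensor product *)

Definition fswap (A B : eqType) (x : fsum A B) : fsum B A :=
  [seq (e.1, (e.2.2, e.2.1)) | e <- x].

Lemma feval_swap (A B : eqType) (H : zmodType) (f : B -> A -> H) (x : fsum A B) :
  feval f (fswap x) = feval (fun a b => f b a) x.
Proof. by rewrite /feval big_map. Qed.

Lemma fswapK (A B : eqType) : cancel (@fswap A B) (@fswap B A).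
Proof. by move=> x; rewrite /fswap -map_comp -[RHS]map_id; apply: eq_map => -[k [a b]]. Qed.

Lemma fswap_in (A B : zmodType) (P : A -> Prop) (Q : B -> Prop) (x : fsum A B) :
  fsum_in P Q x -> fsum_in Q P (fswap x).
Proof. by move=> xPQ _ /mapP[e ex ->] /=; case: (xPQ _ ex). Qed.

(** By the universal property only test maps have to be exchanged: a balanced map stays balanced,
    over the converse ring, when its arguments are swapped. *)
Lemma tensor_zero_swap (S : pzRingType) (A B : zmodType) (ra : A -> S -> A) (la : S -> B -> B)
  (P : A -> Prop) (Q : B -> Prop) (x : fsum A B) : tensor_zero ra la P Q x ->
  tensor_zero (S := S^c) (fun b s => la s b) (fun s a => ra a s) Q P (fswap x).
Proof.
move=> x0; apply: balanced_tensor_zero => H N f sN [fDl fDr fb]; rewrite feval_swap.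
apply: (tensor_zero_balanced x0) => //; split=> // a s b Pa Qb.
by apply: eqmod_sym => //; apply: fb.
Qed.

(** Through it the criterion for left modules applies to right ideals, with all products
    reversed. *)
Lemma flat_right_conv (S : pzRingType) (A : zmodType) (ra : A -> S -> A) (P : A -> Prop) :
  flat_right ra P <-> flat_left (S := S^c) (fun s a => ra a s) P.
Proof.
split=> flatP B act actM Q sQ x xPQ /tensor_zero_swap x0.
  rewrite -[x]fswapK; apply: (@tensor_zero_swap S).
  apply: (flatP B (fun s b => act b s)) => //; last exact: fswap_in.
    by case: actM => actDl actDr actA act1; split=> * //; rewrite -actA.
  by case: sQ => Q0 QB QZ; split=> // s b; apply: QZ.
rewrite -[x]fswapK; apply: (@tensor_zero_swap S^c).
apply: (flatP B (fun b s => act s b)) => //; last exact: fswap_in.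
  exact: lmod_conv.
by case: sQ => Q0 QB QZ; split=> // s b; apply: QZ.
Qed.

(** * Matrices of endomorphisms *)

Lemma additive_on_sum (A C : zmodType) (P : A -> Prop) (h : A -> C) : is_subgroup P ->
  (forall x y, P x -> P y -> h (x + y) = h x + h y) ->
  forall n (u : 'I_n -> A), (forall i, P (u i)) ->
  h (\sum_(i < n) u i) = \sum_(i < n) h (u i).
Proof.
move=> sP hD n u Pu; have s0 : is_subgroup (fun c : C => c = 0).
  by split=> // a b -> ->; rewrite subr0.
apply/eqP; rewrite -subr_eq0; apply/eqP; apply: (eqmod_morph_sum sP s0) => //.
by move=> a b Pa Pb; rewrite /eqmod hD // subrr.
Qed.

(** * Right ideals generated by the entries of a row *)

Definition colspan (S : pzRingType) n (c : 'rV[S]_n) : {pred S} :=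
  fun x => `[< exists d : 'cV[S]_n, c *m d = x%:M >].

Lemma colspanP (S : pzRingType) n (c : 'rV[S]_n) x :
  reflect (exists d : 'cV[S]_n, c *m d = x%:M) (x \in colspan c).
Proof. exact: asboolP. Qed.

Fact colspan_zmod_closed (S : pzRingType) n (c : 'rV[S]_n) : zmod_closed (colspan c).
Proof.
split=> [|x y /colspanP[d dx] /colspanP[e ey]]; apply/colspanP.
  by exists 0; rewrite mulmx0 raddf0.
by exists (d - e); rewrite mulmxBr dx ey raddfB.
Qed.

HB.instance Definition _ (S : pzRingType) n (c : 'rV[S]_n) :=
  GRing.isZmodClosed.Build S (colspan c) (colspan_zmod_closed c).

(** The codomain of a lifting problem in [projective_right] is a [zmodType]; the ideal is therefore
    made a subtype, which is why [colspan] is a boolean predicate. *)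
Record colspan_of (S : pzRingType) n (c : 'rV[S]_n) :=
  Colspan { colspan_val :> S; _ : colspan_val \in colspan c }.

HB.instance Definition _ (S : pzRingType) n (c : 'rV[S]_n) :=
  [isSub for @colspan_val S n c].
HB.instance Definition _ (S : pzRingType) n (c : 'rV[S]_n) :=
  [Choice of colspan_of c by <:].
HB.instance Definition _ (S : pzRingType) n (c : 'rV[S]_n) :=
  [SubChoice_isSubZmodule of colspan_of c by <:].

Lemma colspan_right_ideal (S : pzRingType) n (c : 'rV[S]_n) :
  right_ideal (fun x => x \in colspan c).
Proof.
split=> [|x y|x s /colspanP[d dx]]; [exact: rpred0 | exact: rpredB |].
by apply/colspanP; exists (d *m s%:M); rewrite mulmxA dx scalar_mxM.
Qed.

Lemma colspan_fg (S : pzRingType) n (c : 'rV[S]_n) :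
  fg_right_ideal (fun x => x \in colspan c).
Proof.
exists n, (fun i => c 0 i) => x; split=> [/colspanP[d /matrixP/(_ 0 0)]|[d ->]].
  by rewrite !mxE mulr1n => <-; exists (fun i => d i 0).
apply/colspanP; exists (\col_i d i); apply/matrixP=> i j; rewrite !ord1 !mxE mulr1n.
by apply: eq_bigr => l _; rewrite mxE.
Qed.

Lemma mulmx_scalar11 (S : pzRingType) n (d : 'cV[S]_n) s i : (d *m s%:M) i 0 = d i 0 * s.
Proof. by rewrite mxE big_ord1 mxE mulr1n. Qed.

Lemma mem_colspan (S : pzRingType) n (c : 'rV[S]_n) (d : 'cV[S]_n) :
  (c *m d) 0 0 \in colspan c.
Proof.
by apply/colspanP; exists d; apply/matrixP=> i j; rewrite !ord1 [RHS]mxE mulr1n.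
Qed.

Lemma colspan_entry (S : pzRingType) n (c : 'rV[S]_n) j : c 0 j \in colspan c.
Proof.
by have := mem_colspan c (delta_mx j 0); rewrite -colE mxE.
Qed.

(** Projectivity of the ideal [c S] splits the surjection [d -> c d] from [S^n]. If [k] is a
    section, the columns [k (c 0 j)] form a matrix that [c] absorbs on the right and that kills the
    kernel of [c]; its complement is the required matrix. *)
Lemma semihereditary_row (S : pzRingType) : right_semihereditary S ->
  forall n (c : 'rV[S]_n), exists E : 'M[S]_n,
  c *m E = 0 /\ forall k (D : 'M[S]_(n, k)), c *m D = 0 -> E *m D = D.
Proof.
move=> hS n c.
have sI := rsubmod_subgroup (colspan_right_ideal c).
pose rb (d : 'cV[S]_n) (s : S) : 'cV[S]_n := d *m s%:M.
have colspanM (x : colspan_of c) s : colspan_val x * s \in colspan c.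
  by case: (colspan_right_ideal c) => _ _; apply; apply: valP x.
pose rc (x : colspan_of c) (s : S) : colspan_of c := Colspan (colspanM x s).
pose g (d : 'cV[S]_n) : colspan_of c := Colspan (mem_colspan c d).
have rbM : rmod_ax rb.
  split=> [a b s|a s t|a s t|a]; rewrite /rb.
  - exact: mulmxDl.
  - by rewrite raddfD mulmxDr.
  - by rewrite scalar_mxM mulmxA.
  - exact: mulmx1.
have rcM : rmod_ax rc.
  split=> [a b s|a s t|a s t|a]; apply: val_inj; rewrite /= ?mulrDl ?mulrDr ?mulrA ?mulr1 //.
have gh : rhom_on rb rc (fun=> True) g.
  split=> [x y _ _|x s _]; apply: val_inj => /=.
    by rewrite mulmxDr mxE.
  by rewrite /rb mulmxA mulmx_scalar11.
have gsurj x : exists d, g d = x.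
  have /colspanP[d dx] := valP x; exists d; apply: val_inj.
  by rewrite /= dx mxE mulr1n.
(* The identity of the ideal, as a map on all of [S]: [insubd] returns the default [0] outside the
   ideal, where [rhom_on] imposes nothing. *)
have hh : rhom_on (fun x s : S => x * s) rc (fun x => x \in colspan c) (insubd (0 : colspan_of c)).
  split=> [x y Ix Iy|x s Ix]; apply: val_inj; rewrite /= !insubdK //.
    exact: rpredD.
  by case: (colspan_right_ideal c) => _ _; apply.
have [k [[kD kM] gk]] :=
  hS _ (colspan_right_ideal c) (colspan_fg c) _ _ _ _ rbM rcM g gh gsurj _ hh.
pose E := \matrix_(i, j) k (c 0 j) i 0.
have colE' j : col j E = k (c 0 j) by apply/colP=> i; rewrite !mxE.
exists (1%:M - E); split.
  rewrite mulmxBr mulmx1; apply/eqP; rewrite subr_eq0; apply/eqP/rowP=> j.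
  have := congr1 val (gk _ (colspan_entry c j)); rewrite insubdK ?colspan_entry //= => {1}<-.
  by rewrite -colE' colE mulmxA -colE mxE.
move=> m D cD; rewrite mulmxBl mul1mx (_ : E *m D = 0) ?subr0 //.
apply/matrixP=> i l; rewrite [RHS]mxE.
(* Since [k] is additive and [S]-linear on the ideal, column [l] of [E *m D] is [k] at entry [l] of
   [c *m D], that is [k 0]. *)
have -> : (E *m D) i l = (k ((c *m D) 0 l)) i 0.
  rewrite !mxE (additive_on_sum sI kD) ?summxE.
    apply: eq_bigr => j _; rewrite kM ?colspan_entry //.
    by rewrite /rb mulmx_scalar11 mxE.
  by move=> j; case: (colspan_right_ideal c) => _ _; apply; apply: colspan_entry.
have := kD _ _ sI.1 sI.1; rewrite addr0 -[k 0 in LHS]addr0 => /addrI k0.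
by rewrite cD mxE -k0 mxE.
Qed.

(** * Linear maps and direct summands *)

Lemma linear_pack (K : pzRingType) (U V : lmodType K) (f : U -> V) : linear f ->
  exists g : {linear U -> V}, g =1 f.
Proof.
by move=> lf; exists (HB.pack_for {linear U -> V} f (GRing.isLinear.Build K U V *:%R f lf)).
Qed.

Lemma ker_submod (K : pzRingType) (U V : lmodType K) (f : {linear U -> V}) :
  submodV (fun x => f x = 0).
Proof.
split=> [|x y fx fy|a x fx]; rewrite ?linear0 ?linearB ?linearZ //= ?fx ?fy ?subr0 //.
by rewrite scaler0.
Qed.

(** Two candidates for the component in [P] differ by an element of both [P] and its complement. The
    component is thus unique, and uniqueness makes its choice linear. *)
Lemma direct_summand_proj (K : pzRingType) (V : lmodType K) (P : V -> Prop) :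
  direct_summand P ->
  exists p : {linear V -> V}, (forall x, P (p x)) /\ forall x, P x -> p x = x.
Proof.
move=> [[P0 PB PZ] [Q [[Q0 QB QZ] PQ PQT]]].
have uniq x y y' : P y -> Q (x - y) -> P y' -> Q (x - y') -> y = y'.
  move=> Py Qy Py' Qy'; apply/eqP; rewrite -subr_eq0; apply/eqP.
  apply: PQ; first exact: PB.
  by have := QB _ _ Qy' Qy; rewrite opprB addrC addrA subrK.
have /choice[p pP] : forall x, exists y, P y /\ Q (x - y).
  move=> x; have [y [z [Py Qz ->]]] := PQT x; exists y; split=> //.
  by rewrite addrAC subrr add0r.
have PD := subgroupD (conj P0 PB); have QD := subgroupD (conj Q0 QB).
have plin : linear p.
  move=> a x y; have [[Px Qx] [Py Qy]] := (pP x, pP y); have [Pxy Qxy] := pP (a *: x + y).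
  apply: (uniq (a *: x + y)) => //; first by apply: PD => //; apply: PZ.
  by rewrite opprD addrACA -scalerBr; apply: QD => //; apply: QZ.
have [q qE] := linear_pack plin.
exists q; split=> [x|x Px]; rewrite qE; have [Ppx Qpx] := pP x => //.
by apply: (uniq x) => //; rewrite subrr.
Qed.

(** * Matrices over the endomorphism ring acting on powers of the module *)

Lemma endoD (R : nzRingType) (M : lmodType R^c) (f : endo M) (x y : M) : f (x + y) = f x + f y.
Proof. by case: f => f []. Qed.

Lemma endoZ (R : nzRingType) (M : lmodType R^c) (f : endo M) (a : R^c) (x : M) :
  f (a *: x) = a *: f x.
Proof. by case: f => f []. Qed.

Lemma eval_act_lmod (R : nzRingType) (M : lmodType R^c) : lmod_ax (@eval_act R M).
Proof. by split=> // s a b; apply: endoD. Qed.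

Lemma endo_sumr (R : nzRingType) (M : lmodType R^c) (f : endo M) (I : Type) (r : seq I)
  (P : pred I) (F : I -> M) : f (\sum_(i <- r | P i) F i) = \sum_(i <- r | P i) f (F i).
Proof. exact: (lmod_sumr (@eval_act_lmod R M)). Qed.

Lemma endo_suml (R : nzRingType) (M : lmodType R^c) (I : Type) (r : seq I)
  (P : pred I) (F : I -> endo M) (x : M) :
  (\sum_(i <- r | P i) F i) x = \sum_(i <- r | P i) F i x.
Proof. exact: (lmod_suml (@eval_act_lmod R M)). Qed.

Lemma endo0r (R : nzRingType) (M : lmodType R^c) (f : endo M) : f 0 = 0.
Proof. exact: (lmod_zero (@eval_act_lmod R M)). Qed.

Definition mact (R : nzRingType) (M : lmodType R^c) m n (A : 'M[endo M]_(m, n))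
  (x : {ffun 'I_n -> M}) : {ffun 'I_m -> M} := [ffun i => \sum_(j < n) A i j (x j)].

Fact mact_linear (R : nzRingType) (M : lmodType R^c) m n (A : 'M[endo M]_(m, n)) :
  linear (mact A).
Proof.
move=> a x y; apply/ffunP=> i; rewrite !ffunE scaler_sumr -big_split /=.
by apply: eq_bigr => j _; rewrite !ffunE endoD endoZ.
Qed.

HB.instance Definition _ (R : nzRingType) (M : lmodType R^c) m n (A : 'M[endo M]_(m, n)) :=
  GRing.isLinear.Build R^c {ffun 'I_n -> M} {ffun 'I_m -> M} *:%R (mact A) (mact_linear A).

Lemma mactM (R : nzRingType) (M : lmodType R^c) m n p (A : 'M[endo M]_(m, n))
  (B : 'M[endo M]_(n, p)) x : mact (A *m B) x = mact A (mact B x).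
Proof.
apply/ffunP=> i; rewrite !ffunE.
under eq_bigr do rewrite mxE endo_suml; rewrite exchange_big /=.
by apply: eq_bigr => j _; rewrite ffunE endo_sumr.
Qed.

Lemma mact1 (R : nzRingType) (M : lmodType R^c) n x : mact (1%:M : 'M[endo M]_n) x = x.
Proof.
apply/ffunP=> i; rewrite !ffunE (bigD1 i) //= big1 ?addr0 ?mxE ?eqxx // => j /negPf ij.
by rewrite mxE eq_sym ij.
Qed.

Lemma mact0l (R : nzRingType) (M : lmodType R^c) m n x : mact (0 : 'M[endo M]_(m, n)) x = 0.
Proof. by apply/ffunP=> i; rewrite !ffunE big1 // => j _; rewrite mxE. Qed.

Definition inj_at (R : nzRingType) (M : lmodType R^c) n (j : 'I_n) (x : M) : {ffun 'I_n -> M} :=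
  [ffun i => if i == j then x else 0].

Lemma inj_at_sum (R : nzRingType) (M : lmodType R^c) n (x : {ffun 'I_n -> M}) :
  x = \sum_j inj_at j (x j).
Proof.
apply/ffunP=> i; rewrite sum_ffunE (bigD1 i) //= ffunE eqxx big1 ?addr0 // => j /negPf ij.
by rewrite ffunE eq_sym ij.
Qed.

Fact inj_at_linear (R : nzRingType) (M : lmodType R^c) n (j : 'I_n) : linear (@inj_at R M n j).
Proof.
by move=> a x y; apply/ffunP=> i; rewrite !ffunE; case: eqP => // _; rewrite scaler0 addr0.
Qed.

HB.instance Definition _ (R : nzRingType) (M : lmodType R^c) n (j : 'I_n) :=
  GRing.isLinear.Build R^c M {ffun 'I_n -> M} *:%R (@inj_at R M n j) (@inj_at_linear R M n j).

(** The entry at [i], [j] is read off from vectors supported at [j]. Matrix identities can thus be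
    checked on elements of [M^n]. *)
Lemma mact_inj (R : nzRingType) (M : lmodType R^c) m n (A B : 'M[endo M]_(m, n)) :
  (forall x, mact A x = mact B x) -> A = B.
Proof.
have mactE (C : 'M[endo M]_(m, n)) i j y : mact C (inj_at j y) i = C i j y.
  rewrite ffunE (bigD1 j) //= ffunE eqxx big1 ?addr0 // => l /negPf lj.
  by rewrite ffunE lj endo0r.
by move=> AB; apply/matrixP=> i j; apply: endo_ext => y; rewrite -!mactE AB.
Qed.

Lemma linear_mact (R : nzRingType) (M : lmodType R^c) m n
  (f : {linear {ffun 'I_n -> M} -> {ffun 'I_m -> M}}) :
  exists A : 'M[endo M]_(m, n), forall x, mact A x = f x.
Proof.
have fE i j : is_endo (fun y => f (inj_at j y) i).
  by split=> *; rewrite ?linearD ?linearZ /= ?linearD ?linearZ /= !ffunE.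
exists (\matrix_(i, j) Endo (fE i j)) => x; apply/ffunP=> i.
rewrite [x in RHS]inj_at_sum linear_sum sum_ffunE ffunE.
by apply: eq_bigr => j _; rewrite mxE.
Qed.

Lemma linear_mact_row (R : nzRingType) (M : lmodType R^c) n
  (f : {linear {ffun 'I_n -> M} -> M}) :
  exists c : 'rV[endo M]_n, forall x, mact c x = [ffun=> f x].
Proof.
have fE j : is_endo (fun y => f (inj_at j y)).
  by split=> *; rewrite ?linearD ?linearZ /= ?linearD ?linearZ.
exists (\row_j Endo (fE j)) => x; apply/ffunP=> i.
rewrite [x in RHS]inj_at_sum linear_sum !ffunE.
by apply: eq_bigr => j _; rewrite mxE.
Qed.

(** Idempotence of [E] follows: by [C *m E = 0] its image lies in the kernel of [C], which it
    fixes. *)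
Definition kernels_split (R : nzRingType) (M : lmodType R^c) : Prop :=
  forall m n (C : 'M[endo M]_(m, n)), exists E : 'M[endo M]_n,
  C *m E = 0 /\ forall x, mact C x = 0 -> mact E x = x.

(** Transfers the splitting from [M^n] to matrices over [S]: every value of [D] lies in the kernel
    of [C]. *)
Lemma kernels_split_mulmx (R : nzRingType) (M : lmodType R^c) m n k
  (C : 'M[endo M]_(m, n)) (E : 'M[endo M]_n) (D : 'M[endo M]_(n, k)) :
  (forall x, mact C x = 0 -> mact E x = x) -> C *m D = 0 -> E *m D = D.
Proof.
by move=> CE CD; apply: mact_inj => x; rewrite mactM CE // -mactM CD mact0l.
Qed.

Lemma fin_sigma_rickart_split (R : nzRingType) (M : lmodType R^c) :
  fin_sigma_rickart M <-> kernels_split M.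
Proof.
split=> [rickM m n C|splitM n _ phi].
  (* The Rickart hypothesis speaks of positive exponents only. *)
  have [/eqP|mn] := posnP (m + n).
    rewrite addn_eq0 => /andP[_ /eqP n0]; exists 0; rewrite mulmx0; split=> // x _.
    by apply/ffunP=> -[i lt_i]; exfalso; move: lt_i; rewrite n0.
  (* The rectangular [C] becomes the endomorphism [(x, y) -> (C y, 0)] of [M^(m + n)], with kernel
     [M^m + ker C]; the lower right block of a projection onto it is the required [E]. *)
  pose Phi : 'M[endo M]_(m + n) := col_mx 1%:M 0 *m C *m row_mx 0 1%:M.
  have [p [pK pid]] := direct_summand_proj (rickM _ mn (mact Phi)).
  have [F Fp] := linear_mact p.
  exists (row_mx 0 1%:M *m F *m col_mx 0 1%:M); split=> [|x Cx].
    have PF : Phi *m F = 0.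
      by apply: mact_inj => x; rewrite mactM Fp mact0l; apply: pK.
    transitivity (row_mx 1%:M 0 *m (Phi *m F) *m col_mx 0 1%:M).
    by rewrite /Phi !mulmxA mul_row_col mulmx0 addr0 !mul1mx.
    by rewrite PF mulmx0 mul0mx.
  rewrite !mactM Fp pid.
    by rewrite -mactM mul_row_col mul0mx mul1mx add0r mact1.
  rewrite /= -mactM /Phi -!mulmxA mul_row_col mul0mx mul1mx add0r mulmx1.
  by rewrite mactM Cx linear0.
have [C Cphi] := linear_mact phi; have [E [CE Eid]] := splitM _ _ C.
have phiE x : phi (mact E x) = 0 by rewrite -Cphi -mactM CE mact0l.
split; first exact: ker_submod.
exists (fun x => mact E x = 0); split.
- exact: (ker_submod (mact E)).
- by move=> x px; rewrite Eid // Cphi.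
- move=> x; exists (mact E x), (x - mact E x); split=> //.
    by rewrite linearB /= [mact E (mact E x)]Eid ?subrr // Cphi.
  by rewrite addrC subrK.
Qed.

Lemma kernels_split_rows (R : nzRingType) (M : lmodType R^c) :
  (forall n (c : 'rV[endo M]_n), exists E : 'M[endo M]_n,
    c *m E = 0 /\ forall x, mact c x = 0 -> mact E x = x) -> kernels_split M.
Proof.
move=> rowM; elim=> [|m IH] n C.
  by exists 1%:M; split=> [|x _]; [apply/matrixP=> -[] | rewrite mact1].
rewrite -[m.+1]/(1 + m)%N in C *.
have [E [CE Eid]] := IH _ (dsubmx C).
have [E' [CE' Eid']] := rowM _ (usubmx C *m E).
(* [E] handles the lower rows, and [E'] the first row after composition with [E]. A vector in the
   common kernel is fixed by [E], hence killed by the composite row and fixed by [E']. *)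
exists (E *m E'); split=> [|x Cx].
  rewrite -[C](vsubmxK C) mul_col_mx !mulmxA CE CE' mul0mx.
  exact: col_mx0.
have [ux dx] : mact (usubmx C) x = 0 /\ mact (dsubmx C) x = 0.
  split; apply/ffunP=> i; [move/ffunP/(_ (lshift m i)): Cx | move/ffunP/(_ (rshift 1 i)): Cx];
    rewrite !ffunE => {2}<-; apply: eq_bigr => j _; rewrite mxE //.
by rewrite mactM Eid' ?Eid // mactM Eid.
Qed.

(** * The equivalences *)

(** For [F = 1 - E], the assignment [c d -> F d] is a section of the surjection from [S^n] onto [I].
    Following it by the map that sends the [i]-th basis vector to a preimage of [h (a i)] lifts
    [h]. *)
Lemma kernels_split_semihereditary (R : nzRingType) (M : lmodType R^c) :
  kernels_split M -> right_semihereditary (endo M).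
Proof.
move=> splitM I sI [n [a IE]] B C rb rc rbM rcM g [gD gM] gsurj h [hD hM].
have sgI := rsubmod_subgroup sI; have [_ _ IM] := sI.
pose c := \row_i a i.
have [E [cE Eid]] := splitM _ _ c; pose F := 1%:M - E.
have cF : c *m F = c by rewrite mulmxBr mulmx1 cE subr0.
have Ia i : I (a i).
  apply/IE; exists (fun j => (j == i)%:R); rewrite (bigD1 i) //= eqxx mulr1 big1 ?addr0 //.
  by move=> j /negPf ->; rewrite mulr0.
have /choice[b gb] : forall i, exists b, g b = h (a i) by move=> i; apply: gsurj.
have Id x : I x -> exists d : 'cV_n, c *m d = x%:M.
  case/IE=> d ->; exists (\col_i d i); apply/matrixP=> i j; rewrite !ord1 !mxE mulr1n.
  by apply: eq_bigr => l _; rewrite !mxE.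
pose coef x : 'cV[endo M]_n := if pselect (I x) is left p then sval (cid (Id x p)) else 0.
have coefP x : I x -> c *m coef x = x%:M.
  by rewrite /coef; case: pselect => // p _; case: (cid _).
(* Well-definedness: two coefficient vectors of [x] differ by an element of the kernel of [c], which
   [F] kills. *)
have Fcoef x d : I x -> c *m d = x%:M -> F *m coef x = F *m d.
  move=> Ix cd; apply/eqP; rewrite -subr_eq0 -mulmxBr mulmxBl mul1mx subr_eq0; apply/eqP.
  by rewrite (kernels_split_mulmx Eid) // mulmxBr coefP // cd subrr.
have [rbDl rbDr rbA _] := rbM.
pose k x := \sum_(i < n) rb (b i) ((F *m coef x) i 0).
exists k; split; first split=> [x y Ix Iy|x s Ix].
- rewrite /k -big_split /=; apply: eq_bigr => i _; rewrite -rbDr.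
  rewrite (@Fcoef (x + y) (coef x + coef y)) ?mulmxDr ?coefP ?raddfD ?mxE //.
  exact: (subgroupD sgI).
- rewrite /k (big_morph (rb^~ s) (fun u v => rbDl u v s) (lmod_zero (rmod_conv rbM) s)).
  apply: eq_bigr => i _; rewrite -rbA.
  rewrite (@Fcoef (x * s) (coef x *m s%:M)) ?mulmxA ?mulmx_scalar11 ?coefP ?scalar_mxM //.
  exact: IM.
move=> x Ix; rewrite /k (additive_on_sum (P := fun=> True)) //.
transitivity (h (\sum_(i < n) a i * (F *m coef x) i 0)).
  rewrite (additive_on_sum sgI hD) //; last by move=> i; apply: IM.
  by apply: eq_bigr => i _; rewrite gM // gb hM.
congr (h _); transitivity ((c *m (F *m coef x)) 0 0).
  by rewrite [RHS]mxE; apply: eq_bigr => i _; rewrite [in RHS]mxE.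
by rewrite mulmxA cF coefP // mxE mulr1n.
Qed.

Lemma kernels_split_flat (R : nzRingType) (M : lmodType R^c) :
  kernels_split M -> flat_left (@eval_act R M) (fun=> True).
Proof.
move=> splitM; apply: equational_flat_left => //; first exact: eval_act_lmod.
move=> n r C b _ Cb; have [E [CE Eid]] := splitM _ _ (\matrix_(l, i) C l i).
exists n, (fun i j => E i j), b; split=> // [i|l j].
  have /Eid/ffunP/(_ i) : mact (\matrix_(l, i) C l i) [ffun i => b i] = 0.
    apply/ffunP=> l; rewrite !ffunE -[RHS](Cb l).
    by apply: eq_bigr => j _; rewrite ffunE mxE.
  by rewrite !ffunE => <-; apply: eq_bigr => j _; rewrite ffunE.
have /matrixP/(_ l j) := CE; rewrite !mxE => {2}<-.
by apply: eq_bigr => i _; rewrite mxE.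
Qed.

(** The relations say that the row [b] annihilates the columns of a matrix; [E] fixes these columns,
    so [1 - E] kills them, while [b] is unchanged by [1 - E]. *)
Lemma kernels_split_ideal_flat (R : nzRingType) (M : lmodType R^c) (I : endo M -> Prop) :
  kernels_split M -> right_ideal I -> flat_right (fun x s : endo M => x * s) I.
Proof.
move=> splitM sI; apply/flat_right_conv; apply: equational_flat_left.
- by split=> *; rewrite ?mulrDl ?mulrDr ?mulr1 ?mulrA.
- by case: sI => I0 IB IM; split=> // s b; apply: IM.
move=> n r C b Ib Cb; have [E [bE Eid]] := splitM _ _ (\row_i b i).
have EC : (1%:M - E) *m \matrix_(i, l) C l i = 0.
  rewrite mulmxBl mul1mx (kernels_split_mulmx Eid) ?subrr //.
  apply/matrixP=> i l; rewrite ord1 !mxE -[RHS](Cb l).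
  by apply: eq_bigr => j _; rewrite !mxE.
(* The indices are transposed because the criterion is applied over the converse ring. *)
exists n, (fun i j => (1%:M - E) j i), b; split=> // [i|l j].
  have : (\row_i b i) *m (1%:M - E) = \row_i b i by rewrite mulmxBr mulmx1 bE subr0.
  move/rowP/(_ i); rewrite [RHS]mxE => <-; rewrite mxE.
  by apply: eq_bigr => j _; rewrite mxE.
have /matrixP/(_ j l) := EC; rewrite mxE [RHS]mxE => ECjl; rewrite -[RHS]ECjl.
by apply: eq_bigr => i _; rewrite [X in _ = X * _]mxE.
Qed.

Lemma kernels_split_coherent (R : nzRingType) (M : lmodType R^c) :
  kernels_split M -> M_coherent M (fun _ : M => True).
Proof.
move=> splitM; split.
  have [p pE] : exists p : {linear {ffun 'I_1 -> M} -> M}, p =1 fun x => x 0.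
    by apply: linear_pack => a x y; rewrite !ffunE.
  exists 1%N; split=> //; exists p; split=> // y _.
  by exists [ffun=> y]; rewrite pE ffunE.
move=> n n_gt0 rho _; have [c cE] := linear_mact_row rho.
have [E [cE0 Eid]] := splitM _ _ c.
exists n; split=> //; exists (mact E); split=> [x|x rx] /=.
  have : mact c (mact E x) = 0 by rewrite -mactM cE0 mact0l.
  by rewrite cE => /ffunP/(_ 0); rewrite !ffunE.
exists x; apply: Eid; rewrite cE.
by apply/ffunP=> i; rewrite !ffunE rx.
Qed.

(** Applying [1 - E] to an arbitrary preimage under [alpha] removes the dependence on the choice, so
    the resulting lift is linear. *)
Lemma kernels_split_intrinsically_projective (R : nzRingType) (M : lmodType R^c) :
  kernels_split M -> intrinsically_projective M.
Proof.
move=> splitM n n_gt0 N _ alpha Nalpha alphaN beta Nbeta.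
have [c cE] := linear_mact_row alpha; have [E [cE0 Eid]] := splitM _ _ c.
have alphaE x : alpha (mact E x) = 0.
  have : mact c (mact E x) = 0 by rewrite -mactM cE0 mact0l.
  by rewrite cE => /ffunP/(_ 0); rewrite !ffunE.
have kerE x : alpha x = 0 -> mact E x = x.
  by move=> ax; apply: Eid; rewrite cE; apply/ffunP=> i; rewrite !ffunE ax.
have /choice[y ay] : forall x, exists y, alpha y = beta x.
  by move=> x; apply: alphaN.
pose gamma x := y x - mact E (y x).
have glin : linear gamma.
  move=> a x x'; rewrite /gamma.
  set u := y _; set v := y x; set w := y x'.
  have /kerE : alpha (u - (a *: v + w)) = 0.
    by rewrite linearB linearP /= /u /v /w !ay linearP subrr.
  rewrite linearB linearP /= => uvw.
  rewrite scalerBr addrACA -opprD.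
  by apply/eqP; rewrite subr_eq -[eqbRHS]addrA [- (_ + _) + _]addrC uvw addrC subrK.
have [gam gamE] := linear_pack glin; exists gam => x.
by rewrite gamE /gamma linearB /= alphaE subr0 ay.
Qed.

(** [E] already fixes the matrices over [S] killed by [c]; flatness writes each [x] in the kernel on
    [M^n] as such a matrix applied to a vector. *)
Lemma semihereditary_flat_split (R : nzRingType) (M : lmodType R^c) :
  right_semihereditary (endo M) -> flat_left (@eval_act R M) (fun=> True) ->
  kernels_split M.
Proof.
move=> hS flatMl.
have flatM : equational_flat (@eval_act R M) (fun=> True).
  by apply: flat_left_equational => //; apply: eval_act_lmod.
apply: kernels_split_rows => n c.
have [E [cE Eid]] := semihereditary_row hS c; exists E; split=> // x cx.
have [//|l|k [D [y [_ xD cD]]]] := flatM n 1%N (fun l i => c l i) (fun i => x i).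
  by move/ffunP/(_ l): cx; rewrite !ffunE.
have -> : x = mact (\matrix_(i, j) D i j) [ffun j => y j].
  apply/ffunP=> i; rewrite xD ffunE; apply: eq_bigr => j _.
  by rewrite ffunE mxE.
rewrite -mactM Eid //; apply/matrixP=> l j; rewrite mxE [RHS]mxE -[RHS](cD l j).
by apply: eq_bigr => i _; rewrite mxE.
Qed.

Lemma coherent_ideal_flat_split (R : nzRingType) (M : lmodType R^c) :
  M_coherent M (fun _ : M => True) ->
  (forall I : endo M -> Prop, right_ideal I -> flat_right (fun x s : endo M => x * s) I) ->
  kernels_split M.
Proof.
move=> [_ cohM] flatI; apply: kernels_split_rows => n c.
have [n0|n_gt0] := posnP n.
  exists 0; rewrite mulmx0; split=> // x _.
  by apply/ffunP=> -[i lt_i]; exfalso; move: lt_i; rewrite n0.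
have [rho rhoE] : exists rho : {linear {ffun 'I_n -> M} -> M}, rho =1 fun x => mact c x 0.
  by apply: linear_pack => a x y; rewrite linearP !ffunE.
have [//|m [_ [tau [tauK Ktau]]]] := cohM n n_gt0 rho.
have [T Ttau] := linear_mact tau.
have cT : c *m T = 0.
  apply: mact_inj => x; rewrite mactM mact0l Ttau; apply/ffunP=> i.
  by rewrite ord1 [RHS]ffunE; rewrite -rhoE; apply: tauK.
have sI := colspan_right_ideal c; have [I0 IB IM] := sI.
have flatc : equational_flat (S := (endo M)^c) (fun s x : endo M => x * s)
    (fun x => x \in colspan c).
  apply: flat_left_equational; last exact/flat_right_conv/flatI.
    by split=> *; rewrite ?mulrDl ?mulrDr ?mulr1 ?mulrA.
  by split=> // s b; apply: IM.
(* The [m] equations on the entries of [c] are the columns of [c *m T = 0]. *)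
have [i|l|k [D [y [Iy cD TD]]]] := flatc n m (fun l i => T i l) (fun i => c 0 i).
- exact: colspan_entry.
- by have /matrixP/(_ 0 l) := cT; rewrite mxE [RHS]mxE => cTl; rewrite -[RHS]cTl.
have /choice[F yF] : forall j, exists d : 'cV[endo M]_n, c *m d = (y j)%:M.
  by move=> j; apply/colspanP.
pose F' := \matrix_(i, j) F j i 0; pose D' : 'M[endo M]_(k, n) := \matrix_(j, i) D i j.
have cFD : c *m F' *m D' = c.
  apply/rowP=> i; rewrite cD mxE; apply: eq_bigr => j _; rewrite [D' _ _]mxE; congr (_ * _).
  have /matrixP/(_ 0 0) := yF j; rewrite mxE [RHS]mxE mulr1n => <-.
  by rewrite mxE; apply: eq_bigr => l _; rewrite [F' _ _]mxE.
have DT : D' *m T = 0.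
  apply/matrixP=> j l; rewrite mxE [RHS]mxE -[RHS](TD l j).
  by apply: eq_bigr => i _; rewrite [D' _ _]mxE.
(* [c] is absorbed by [F' *m D'], while a kernel element has the form [T z] and is killed by
   [D']. *)
exists (1%:M - F' *m D'); split=> [|x cx].
  by rewrite mulmxBr mulmx1 mulmxA cFD subrr.
have [|z <-] := Ktau x; first by rewrite rhoE cx ffunE.
by rewrite -Ttau -mactM mulmxBl mul1mx -mulmxA DT mulmx0 subr0.
Qed.

Theorem mainTheorem16 (R : nzRingType) (M : lmodType R^c) :
  (fin_sigma_rickart M <->
     right_semihereditary (endo M) /\ flat_left (@eval_act R M) (fun _ => True)) /\
  (fin_sigma_rickart M <->
     [/\ intrinsically_projective M,
         M_coherent M (fun _ : M => True) &
         forall I : endo M -> Prop, right_ideal I -> flat_right (fun x s : endo M => x * s) I]).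
Proof.
split; split.
- move/fin_sigma_rickart_split=> splitM; split; first exact: kernels_split_semihereditary.
  exact: kernels_split_flat.
- by case=> hS flatM; apply/fin_sigma_rickart_split; apply: semihereditary_flat_split.
- move/fin_sigma_rickart_split=> splitM; split.
  + exact: kernels_split_intrinsically_projective.
  + exact: kernels_split_coherent.
  + by move=> I; apply: kernels_split_ideal_flat.
- by case=> _ cohM flatI; apply/fin_sigma_rickart_split; apply: coherent_ideal_flat_split.
Qed.
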